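(* Let $\Omega\subseteq\mathbb{R}^n$ be open, $u:\Omega\to\mathbb{R}^N$ continuous, $x\in\Omega$, $\xi\in\mathbb{S}^{N-1}$ and $P\in\mathbb{R}^{N\times n}$. The following are equivalent: (i) $P\in J^{1,\xi}u(x)$; (ii) there exists an increasing $\sigma\in C^1(0,\infty)$ with $\sigma(0^+)=0$ such that, as $z\to0$, $$\xi^\top\big(u(z+x)-u(x)-Pz\big)\le-\frac{|\xi^\perp(u(z+x)-u(x)-Pz)|^2}{\sigma(|z|)|z|}+\sigma(|z|)|z|.$$
   Context: For $a,b\in\mathbb{R}^N$, $a\vee b:=\frac12(a\otimes b+b\otimes a)$; matrix inequalities are in the sense of quadratic forms; $\xi^\perp:=I-\xi\otimes\xi$. First contact jet: $J^{1,\xi}u(x)$ is the set of $P\in\mathbb{R}^{N\times n}$ for which there is a continuous $T:\mathbb{R}^n\setminus\{0\}\to\mathbb{R}^{N\times N}_s$ (symmetric matrices) with $|T(y)|\to0$ as $y\to0$ and $\xi\vee[u(z)-u(x)-P(z-x)]\le|z-x|\,T(z-x)$ for all $z\ne x$ near $x$. ''As $z\to0$'' means for all $z\neq 0$ sufficiently small. *)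

(* Defs.v *)
From HB Require Import structures.
From mathcomp Require Import all_boot all_order all_algebra.
From mathcomp Require Import all_classical all_reals all_analysis.
Set Implicit Arguments. Unset Strict Implicit. Unset Printing Implicit Defensive.
Import Order.TTheory GRing.Theory Num.Theory.
Import numFieldNormedType.Exports.
Local Open Scope classical_set_scope.
Local Open Scope ring_scope.

Definition enorm (R : realType) (k : nat) (v : 'cV[R]_k) : R :=
  Num.sqrt (\sum_(i < k) v i 0 ^+ 2).

Definition dotv (R : realType) (k : nat) (a b : 'cV[R]_k) : R := (a^T *m b) 0 0.

Definition vee (R : realType) (k : nat) (a b : 'cV[R]_k) : 'M[R]_k :=
  2^-1 *: (a *m b^T + b *m a^T).

Definition perp (R : realType) (k : nat) (xi : 'cV[R]_k) : 'M[R]_k :=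
  1%:M - xi *m xi^T.

Definition mxle (R : realType) (k : nat) (A B : 'M[R]_k) : Prop :=
  forall v : 'cV[R]_k, (v^T *m A *m v) 0 0 <= (v^T *m B *m v) 0 0.

Definition J1 (R : realType) (n N : nat) (Omega : set 'cV[R]_n)
    (u : 'cV[R]_n -> 'cV[R]_N) (x : 'cV[R]_n) (xi : 'cV[R]_N) : set 'M[R]_(N, n) :=
  [set P | exists T : 'cV[R]_n -> 'M[R]_N,
     (forall y, y != 0 -> (T y)^T = T y) /\
     {within [set y | y != 0], continuous T} /\
     T y @[y --> (0 : 'cV[R]_n)^'] --> (0 : 'M[R]_N) /\
     exists delta : R, 0 < delta /\
       forall z, Omega z -> 0 < enorm (z - x) -> enorm (z - x) < delta ->
         mxle (vee xi (u z - u x - P *m (z - x)))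
              (enorm (z - x) *: T (z - x))].

(* Main.v *)
Require Import Defs.
From HB Require Import structures.
From mathcomp Require Import all_boot all_order all_algebra.
From mathcomp Require Import all_classical all_reals all_analysis.
From mathcomp Require Import ring lra.
Import Order.TTheory GRing.Theory Num.Theory.
Import numFieldNormedType.Exports.
Local Open Scope classical_set_scope.
Local Open Scope ring_scope.

(** With w = u(z+x) - u(x) - Pz, a = <xi,w>, q = xi^perp w and l > 0, the matrix inequality xi \vee w <= l I says <xi,v><w,v> <= l|v|^2 for all v. Testing it with v = 2l xi + q gives |q|^2 <= 4l(l - a); conversely, if |q|^2 <= s(s - a), then expanding 0 <= |2s p - <xi,v> q|^2 with p = xi^perp v gives <xi,v><w,v> <= s|v|^2. So (ii) yields (i) with T(y) = sigma(|y|) I, and (i) yields (ii) as soon as some increasing C^1 function sigma vanishing at 0+ dominates 4T in the sense of quadratic forms. Such a sigma is t plus a sum over k of 2^-k phi(t/d_k), with phi(r) = 1 - max(1-r,0)^2 and d_k so small that 4T <= 2^-k on 0 < |y| < d_k: near any t > 0 all but finitely many summands are constant, so no uniform convergence of derivatives is involved. *)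

(** Dividing the error bound by h leaves at most C|h|, which tends to 0. *)
Lemma is_derive_quadratic_error (R : realType) (f : R -> R) (x d C : R) :
  (forall h, `|f (h + x) - f x - d * h| <= C * h ^+ 2) -> is_derive x 1 f d.
Proof.
move=> fE.
have C0 : 0 <= C.
  by have := fE 1; rewrite expr1n !mulr1; exact: le_trans (normr_ge0 _).
have cf : (fun h : R => h^-1 *: ((f \o shift x) (h *: (1 : R)) - f x)) @ 0^' --> d.
  apply/cvgrPdist_le => e e0; near=> h.
  have h0 : h != 0 by near: h; exact: nbhs_dnbhs_neq.
  (* The denominator is C + 1 because C may be 0. *)
  have he : `|h| < e / (C + 1).
    near: h; apply: dnbhs0_lt; apply: divr_gt0 => //.
    by rewrite ltr_wpDl.
  rewrite /= /GRing.scale /= mulr1.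
  have -> : d - h^-1 * (f (h + x) - f x) = - (h^-1 * (f (h + x) - f x - d * h)).
    by field.
  rewrite normrN normrM normfV ler_pdivrMl ?normr_gt0 //.
  apply: (le_trans (fE h)); rewrite -real_normK ?num_real // expr2 mulrCA.
  apply: ler_wpM2l => //.
  rewrite ltr_pdivlMr ?ltr_wpDl // in he.
  have := normr_ge0 h; nra.
apply: DeriveDef; first by apply/cvg_ex; exists d.
exact: cvg_lim.
Unshelve. all: by end_near.
Qed.

(** * Smooth increasing staircases *)

Section Staircase.
Context {R : realType}.
Implicit Types (d : nat -> R) (s t : R) (k K L : nat).

(** The derivative of max(r,0)^2 is 2-Lipschitz, so the first-order error is at most the square of
    the increment e h, whatever the signs. *)
Lemma is_derive_hinge (e t : R) :
  is_derive t 1 (fun t => Num.max (1 - e * t) 0 ^+ 2)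
    (- (2 * e * Num.max (1 - e * t) 0)).
Proof.
apply: (@is_derive_quadratic_error _ _ _ _ (e ^+ 2)) => h.
rewrite ler_norml !maxEle.
by case: (leP (1 - e * (h + t)) 0); case: (leP (1 - e * t) 0) => ? ?;
  apply/andP; split; nra.
Qed.

(* [t + \sum_k 2^-k * phi (t / d k)] with the summands of index [k >= K] replaced by [2^-k]; the constant 2 is [\sum_k 2^-k]. *)
Definition stairs d K t : R :=
  t + 2 - \sum_(k < K) 2^-k * Num.max (1 - (d k)^-1 * t) 0 ^+ 2.

Definition dstairs d K t : R :=
  1 + \sum_(k < K) 2^-k * (2 * (d k)^-1 * Num.max (1 - (d k)^-1 * t) 0).

Lemma stairsS d K t :
  stairs d K.+1 t = stairs d K t - 2^-K * Num.max (1 - (d K)^-1 * t) 0 ^+ 2.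
Proof. by rewrite /stairs big_ord_recr /= opprD addrA. Qed.

Lemma is_derive_stairs d K t : is_derive t 1 (stairs d K) (dstairs d K t).
Proof.
elim: K => [|K IH].
  have -> : stairs d 0 = (id + cst 2).
    by apply/funext => s; rewrite /stairs big_ord0 subr0.
  by apply: is_derive_eq; rewrite /dstairs big_ord0.
have -> : stairs d K.+1 =
    stairs d K - 2^-K *: (fun t => Num.max (1 - (d K)^-1 * t) 0 ^+ 2).
  by apply/funext => s; rewrite stairsS.
have ih := is_derive_hinge (d K)^-1 t.
apply: is_derive_eq.
by rewrite /dstairs big_ord_recr /= scalerN opprK addrA.
Qed.

Lemma continuous_dstairs d K : continuous (dstairs d K).
Proof.
move=> t; apply: cvgD; first exact: cvg_cst.
apply: cvg_big => [|k _]; first exact: add_continuous.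
do 2![apply: cvgM; first exact: cvg_cst].
apply: (@continuous_max _ _ (fun s => 1 - (d k)^-1 * s) (cst 0)).
  by apply: cvgB; [exact: cvg_cst|apply: cvgM; [exact: cvg_cst|exact: cvg_id]].
exact: cvg_cst.
Qed.

(** The subtracted hinges are nonincreasing, so the summand t alone bounds the increments from
    below; strict monotonicity of the staircase comes from here. *)
Lemma stairs_le d K s t : (forall k, 0 < d k) ->
  s <= t -> stairs d K s + (t - s) <= stairs d K t.
Proof.
move=> d0 st; elim: K => [|K IH]; first by rewrite /stairs !big_ord0; lra.
rewrite !stairsS.
suff : 2^-K * Num.max (1 - (d K)^-1 * t) 0 ^+ 2 <=
       2^-K * Num.max (1 - (d K)^-1 * s) 0 ^+ 2 by lra.
apply: ler_wpM2l; first by rewrite invr_ge0 exprn_ge0.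
have h : 1 - (d K)^-1 * t <= 1 - (d K)^-1 * s.
  by rewrite lerD2l lerN2 ler_wpM2l // invr_ge0 ltW.
by apply: lerXn2r; rewrite ?nnegrE ?ge_max !le_max ?h lexx ?orbT.
Qed.

(** For t >= 0 the hinges are at most 1, so at most 2 - 2 * 2^-K is subtracted from the constant
    2. *)
Lemma stairs_ge d K t : 0 <= t -> (forall k, 0 < d k) ->
  t + 2 * 2^-K <= stairs d K t.
Proof.
move=> t0 d0; elim: K => [|K IH].
  by rewrite /stairs big_ord0 expr0 invr1; lra.
rewrite stairsS.
have : 2^-K * Num.max (1 - (d K)^-1 * t) 0 ^+ 2 <= 2^-K * 1.
  apply: ler_wpM2l; first by rewrite invr_ge0 exprn_ge0.
  apply: exprn_ile1; first by rewrite le_max lexx orbT.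
  rewrite ge_max ler01 andbT gerBl mulr_ge0 //.
  by rewrite invr_ge0 ltW.
have -> : 2 * 2^-K.+1 = 2^-K :> R.
  by rewrite exprS invfM mulrA mulfV ?mul1r ?pnatr_eq0.
move: IH; move: (2^-K : R) => p; lra.
Qed.

Lemma stairs_at0 d K : stairs d K 0 = 2 * 2^-K.
Proof.
elim: K => [|K IH]; first by rewrite /stairs big_ord0 expr0 add0r subr0 divr1.
rewrite stairsS IH mulr0 subr0 max_l // expr1n exprS.
by field; rewrite expf_neq0.
Qed.

Lemma stairs_anti d K L t : (K <= L)%N -> stairs d L t <= stairs d K t.
Proof.
move=> /subnK <-; elim: (L - K)%N => [|m IH] //.
rewrite addSn stairsS; apply: le_trans IH.
by rewrite gerBl mulr_ge0 ?invr_ge0 ?exprn_ge0 // le_max lexx orbT.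
Qed.

Lemma stairs_stableS d K t : 0 < d K -> d K <= t ->
  stairs d K.+1 t = stairs d K t.
Proof.
move=> d0 dt; rewrite stairsS max_r ?expr0n ?mulr0 ?subr0 //.
by rewrite subr_le0 mulrC ler_pdivlMr // mul1r.
Qed.

Lemma stairs_stable d K L t : (K <= L)%N -> (forall k, 0 < d k) ->
  (forall k, (K <= k)%N -> d k <= t) -> stairs d L t = stairs d K t.
Proof.
move=> /subnK <- d0 dt; elim: (L - K)%N => [|m IH] //.
by rewrite addSn stairs_stableS // dt // leq_addl.
Qed.

(* [stairs d K t] no longer depends on [K] once [d k <= t] for all [k >= K]; the index [truncn t^-1] is large enough when [d k <= 1 / (k + 1)]. *)
Definition staircase d t := stairs d (Num.truncn t^-1) t.

(** Both indices lie where the partial sums are already stable. Away from 0 the staircase is thus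
    one finite sum, from which it inherits its regularity. *)
Lemma staircaseE d K t : (forall k, 0 < d k) -> (forall k, d k <= k.+1%:R^-1) ->
  K.+1%:R^-1 <= t -> staircase d t = stairs d K t.
Proof.
move=> d0 d1 Kt.
have t0 : 0 < t by apply: lt_le_trans Kt; rewrite invr_gt0.
have dle L : L.+1%:R^-1 <= t -> forall k, (L <= k)%N -> d k <= t.
  move=> Lt k Lk; apply: (le_trans (d1 k)); apply: le_trans Lt.
  by rewrite lef_pV2 ?posrE // ler_nat.
have Tt : (Num.truncn t^-1).+1%:R^-1 <= t.
  rewrite -[leRHS]invrK lef_pV2 ?posrE ?invr_gt0 //.
  by apply/ltW; exact: truncnS_gt.
rewrite /staircase; case/orP: (leq_total K (Num.truncn t^-1)) => h.
  by apply: stairs_stable => //; exact: dle.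
by apply/esym; apply: stairs_stable => //; exact: dle.
Qed.

(** [G t e] stands for: e is an admissible bound at radius t. A relation avoids taking suprema over
    spheres. *)
Lemma increasing_C1_majorant (G : R -> R -> Prop) :
  (forall t e f, G t e -> e <= f -> G t f) ->
  (forall e, 0 < e -> exists2 r : R, 0 < r & forall t, 0 < t -> t < r -> G t e) ->
  exists sigma : R -> R,
  [/\ forall s t, 0 < s -> s < t -> sigma s < sigma t,
      forall t, 0 < t -> derivable sigma t 1,
      forall t, 0 < t -> derive1 sigma s @[s --> t] --> derive1 sigma t,
      sigma s @[s --> 0^'+] --> 0 &
      exists2 r : R, 0 < r & forall t, 0 < t -> t < r -> G t (sigma t)].
Proof.
move=> Gle Gsmall.
have p2 K : (0 : R) < 2^-K by rewrite invr_gt0 exprn_gt0.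
have /choice[d0 d0P] k : exists r : R, 0 < r /\ forall t, 0 < t -> t < r -> G t (2^-k).
  by have [r ? ?] := Gsmall _ (p2 k); exists r.
(* The cap 1 / (k + 1) gives [d k] the explicit decay on which the index in [staircase] relies. *)
pose d k := Num.min (d0 k) k.+1%:R^-1.
have dgt0 k : 0 < d k by rewrite lt_min (d0P k).1 invr_gt0 ltr0Sn.
have dle k : d k <= k.+1%:R^-1 by rewrite ge_min lexx orbT.
have dG k t : 0 < t -> t < d k -> G t (2^-k).
  by move=> t0; rewrite lt_min => /andP[td _]; exact: (d0P k).2.
have idx t : 0 < t -> exists K : nat, K.+1%:R^-1 < t.
  move=> t0; exists (Num.truncn t^-1).
  by rewrite invf_plt ?posrE //; exact: truncnS_gt.
have sigmaE K t : K.+1%:R^-1 <= t -> staircase d t = stairs d K t.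
  exact: staircaseE.
(* Strictness leaves room for a whole neighbourhood of t, so derivatives carry over from
   [stairs d K]. *)
have nearE K t : K.+1%:R^-1 < t -> \near t, stairs d K t = staircase d t.
  move=> Kt; near=> s; rewrite (sigmaE K) // ltW //; near: s; exact: lt_nbhsr.
have der K t : K.+1%:R^-1 < t -> is_derive t 1 (staircase d) (dstairs d K t).
  move=> Kt; apply: near_eq_is_derive (is_derive_stairs d K t); exact: nearE.
have derE K t : K.+1%:R^-1 < t -> derive1 (staircase d) t = dstairs d K t.
  by move=> Kt; rewrite derive1E; have := der _ _ Kt => ?; rewrite derive_val.
have mono s t : 0 < s -> s < t -> staircase d s < staircase d t.
  move=> s0 st; have [K Ks] := idx _ s0.
  rewrite (sigmaE K s (ltW Ks)) (sigmaE K t); last exact: (ltW (lt_trans Ks st)).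
  have := stairs_le d K s t dgt0 (ltW st); move: (stairs d K s) => ?; lra.
exists (staircase d); split => //.
- by move=> t t0; have [K Kt] := idx _ t0; have := der _ _ Kt => ?; exact: ex_derive.
- move=> t t0; have [K Kt] := idx _ t0; rewrite (derE K) //.
  apply: cvg_trans (continuous_dstairs d K t); apply: near_eq_cvg.
  by near=> s; rewrite (derE K) //; near: s; exact: lt_nbhsr.
- apply/cvgrPdist_lt => e e0.
  (* [stairs d K] is continuous with value 2 * 2^-K < e at 0, and it bounds the staircase from
     above, since the index computing the latter can be raised to at least K. *)
  have [K Ke] : exists K : nat, 2 * 2^-K < e.
    exists (Num.truncn (2 / e)).+1; rewrite ltr_pdivrMr ?exprn_gt0 //.
    rewrite -ltr_pdivrMl // mulrC; apply: (lt_le_trans (truncnS_gt _)).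
    by rewrite -natrX ler_nat ltnW // ltn_expl.
  have /cvg_at_right_filter : stairs d K t @[t --> 0] --> stairs d K 0.
    apply: differentiable_continuous; apply/derivable1_diffP.
    by have := is_derive_stairs d K 0 => ?; exact: ex_derive.
  rewrite stairs_at0 => /cvgr_lt/(_ _ Ke) sKe.
  near=> t; have t0 : 0 < t by near: t; exact: nbhs_right_gt.
  have [L /ltW Lt] := idx _ t0.
  have Mt : (maxn K L).+1%:R^-1 <= t.
    apply: le_trans Lt.
    by rewrite lef_pV2 ?posrE ?ltr0Sn // ler_nat ltnS leq_maxr.
  have st0 : 0 <= staircase d t.
    rewrite (sigmaE _ _ Mt); apply: le_trans (stairs_ge _ _ _ (ltW t0) dgt0).
    by rewrite addr_ge0 ?mulr_ge0 // ltW.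
  rewrite sub0r normrN ger0_norm // (sigmaE _ _ Mt).
  apply: (le_lt_trans (stairs_anti d _ _ t (leq_maxl K L))).
  by near: t; exact: sKe.
- exists (d 0) => // t t0 td.
  have [K /ltW Kt] := idx _ t0.
  rewrite (sigmaE _ _ Kt).
  have : forall k, (K <= k)%N -> d k <= t.
    move=> k Kk; apply: (le_trans (dle k)); apply: le_trans Kt.
    by rewrite lef_pV2 ?posrE ?ltr0Sn // ler_nat.
  (* Descend to the last k with t < [d k], which exists since t < [d 0]: later hinges vanish at t,
     [G t (2^-k)] holds by the choice of [d k], and [stairs_ge] at k + 1 gives at least 2^-k. *)
  elim: K {Kt} => [/(_ 0)|K IH dK]; first by rewrite leNgt td => /(_ isT).
  case: (leP (d K) t) => dKt.
    rewrite stairs_stableS //; apply: IH => k; rewrite leq_eqVlt.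
    by case/predU1P => [<-//|]; exact: dK.
  apply: (Gle _ _ _ (dG _ _ t0 dKt)).
  have := stairs_ge d K.+1 t (ltW t0) dgt0; apply: le_trans.
  by rewrite exprS invfM mulrA mulfV ?mul1r ?pnatr_eq0 // lerDr ltW.
Unshelve. all: by end_near.
Qed.

End Staircase.

(** * Euclidean norm, quadratic forms and the splitting along xi *)

Section EuclideanSpace.
Context {R : realType} {k : nat}.
Implicit Types (a b c v w xi : 'cV[R]_k) (A : 'M[R]_k).

Lemma dotvE a b : dotv a b = \sum_i a i 0 * b i 0.
Proof. by rewrite /dotv !mxE; apply: eq_bigr => i _; rewrite mxE. Qed.

Lemma dotvC a b : dotv a b = dotv b a.
Proof. by rewrite !dotvE; apply: eq_bigr => i _; rewrite mulrC. Qed.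

Lemma dotvDr a b c : dotv a (b + c) = dotv a b + dotv a c.
Proof. by rewrite /dotv mulmxDr mxE. Qed.

Lemma dotvZr a b (s : R) : dotv a (s *: b) = s * dotv a b.
Proof. by rewrite /dotv -scalemxAr mxE. Qed.

Lemma dotvDl a b c : dotv (a + b) c = dotv a c + dotv b c.
Proof. by rewrite dotvC dotvDr !(dotvC c). Qed.

Lemma dotvZl a b (s : R) : dotv (s *: a) b = s * dotv a b.
Proof. by rewrite dotvC dotvZr dotvC. Qed.

Lemma dotv_ge0 a : 0 <= dotv a a.
Proof. by rewrite dotvE sumr_ge0 // => i _; rewrite -expr2 sqr_ge0. Qed.

Lemma sqr_enorm a : enorm a ^+ 2 = dotv a a.
Proof.
rewrite dotvE sqr_sqrtr; last by apply: sumr_ge0 => i _; exact: sqr_ge0.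
by apply: eq_bigr => i _; rewrite expr2.
Qed.

Lemma enorm_ge0 a : 0 <= enorm a.
Proof. exact: sqrtr_ge0. Qed.

Lemma coord_le_enorm a (i : 'I_k) (j : 'I_1) : `|a i j| <= enorm a.
Proof.
rewrite ord1 -sqrtr_sqr ler_wsqrtr // (bigD1 i) //= lerDl sumr_ge0 // => l _.
exact: sqr_ge0.
Qed.

(** The left side is the largest absolute entry, the norm behind the topology; the comparison turns
    Euclidean radii into neighbourhoods of 0. *)
Lemma normv_le_enorm a : `|a| <= enorm a.
Proof.
rewrite /Num.norm /= mx_normrE; apply: bigmax_le => [|[i j] _ /=].
  exact: enorm_ge0.
exact: coord_le_enorm.
Qed.

Lemma enorm_gt0 a : (0 < enorm a) = (a != 0).
Proof.
apply/idP/idP => [|a0].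
  apply: contraTneq => ->; rewrite /enorm big1 ?sqrtr0 ?ltxx // => i _.
  by rewrite mxE expr0n.
by apply: lt_le_trans (normv_le_enorm a); rewrite normr_gt0.
Qed.

Lemma continuous_enorm : continuous (@enorm R k).
Proof.
have sum_cvg (F : set_system 'cV[R]_k) (a : 'cV[R]_k) : Filter F ->
    (forall i, (v : 'cV[R]_k) i 0 @[v --> F] --> a i 0) ->
    \sum_i (v : 'cV[R]_k) i 0 ^+ 2 @[v --> F] --> \sum_i a i 0 ^+ 2.
  move=> FF va; apply: cvg_big => [|i _]; first exact: add_continuous.
  exact: (cvgM (va i) (va i)).
move=> a; apply: cvg_comp (sum_cvg _ a (nbhs_filter a) _) _.
  by move=> i; exact: coord_continuous.
exact: sqrt_continuous.
Qed.

(** The norm is positive off 0, so only values to the right of 0 matter; this carries sigma(0+) = 0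
    over to T. *)
Lemma cvg_enorm_at_right : (@enorm R k) @ (0 : 'cV[R]_k)^' --> 0^'+.
Proof.
have enorm0 : enorm (0 : 'cV[R]_k) = 0.
  by apply/le_anti; rewrite enorm_ge0 leNgt enorm_gt0 eqxx.
have enorm_cvg0 : @enorm R k @ (0 : 'cV[R]_k) --> 0.
  by rewrite -[X in _ --> X]enorm0; exact: continuous_enorm.
move=> A A0.
have cA : \forall y \near (0 : 'cV[R]_k), 0 < enorm y -> A (enorm y).
  exact: (enorm_cvg0 _ A0).
have cA' : \forall y \near (0 : 'cV[R]_k)^', 0 < enorm y -> A (enorm y).
  exact: (cvg_within _ cA).
have y0 : \forall y \near (0 : 'cV[R]_k)^', y != 0 by exact: nbhs_dnbhs_neq.
by apply: filterS2 cA' y0 => y yA; rewrite -enorm_gt0.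
Qed.

Lemma quad_vee a b v : (v^T *m vee a b *m v) 0 0 = dotv a v * dotv b v.
Proof.
rewrite /vee -scalemxAr -scalemxAl mxE mulmxDr mulmxDl mxE !mulmxA.
rewrite -[v^T *m a *m b^T *m v]mulmxA -[v^T *m b *m a^T *m v]mulmxA.
rewrite !mxE !big_ord1 -!/(dotv _ _) !(dotvC v).
by field.
Qed.

(** Each of the k^2 products v_i A_ij v_j is at most the largest absolute entry of A times the
    squared Euclidean norm of v. *)
Lemma quad_le A v : (v^T *m A *m v) 0 0 <= `|A| * k%:R ^+ 2 * enorm v ^+ 2.
Proof.
rewrite mxE; under eq_bigr => i _ do rewrite mxE big_distrl /=.
have Aij i j : `|A i j| <= `|A|.
  rewrite [leRHS]/Num.norm /= mx_normrE.
  exact: (le_bigmax _ (fun ij => `|A ij.1 ij.2|) (i, j)).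
have -> : `|A| * k%:R ^+ 2 * enorm v ^+ 2 =
    \sum_(i < k) \sum_(j < k) (enorm v * `|A| * enorm v).
  by rewrite !sumr_const card_ord -mulrnA -[RHS]mulr_natl natrM; ring.
apply: ler_sum => i _; apply: ler_sum => j _; rewrite mxE.
apply: (le_trans (ler_norm _)); rewrite !normrM.
by do ?[apply: ler_pM => //]; rewrite ?mulr_ge0 ?coord_le_enorm.
Qed.

Lemma perpE xi w : perp xi *m w = w - dotv xi w *: xi.
Proof.
rewrite /perp mulmxBl mul1mx -mulmxA; congr (_ - _).
by apply/matrixP => i j; rewrite !mxE big_ord1 !ord1 mulrC.
Qed.

Lemma dotv_perp xi w : enorm xi = 1 -> dotv xi (perp xi *m w) = 0.
Proof.
move=> x1; rewrite perpE -scaleNr dotvDr dotvZr -sqr_enorm x1 expr1n mulr1.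
exact: subrr.
Qed.

Lemma perp_decomp xi w : w = dotv xi w *: xi + perp xi *m w.
Proof. by rewrite perpE addrC subrK. Qed.

Lemma vee_le_perp xi w (l : R) : enorm xi = 1 -> 0 < l ->
  (forall v, dotv xi v * dotv w v <= l * dotv v v) ->
  enorm (perp xi *m w) ^+ 2 <= 4 * l * (l - dotv xi w).
Proof.
move=> x1 l0 wl; have xx : dotv xi xi = 1 by rewrite -sqr_enorm x1 expr1n.
have xq := dotv_perp xi w x1; have wE := perp_decomp xi w.
rewrite sqr_enorm; move: xq wE (wl ((2 * l) *: xi + perp xi *m w)).
move: (perp xi *m w) => q; move: (dotv xi w) => a xq ->.
rewrite !(dotvDl, dotvDr, dotvZl, dotvZr) (dotvC q xi) xq xx => h.
(* The test reads 2l (2l a + |q|^2) <= l (4l^2 + |q|^2), which is l times the claim. *)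
rewrite -subr_ge0 -(pmulr_rge0 _ l0); lra.
Qed.

Lemma perp_le_vee xi w (s : R) : enorm xi = 1 -> 0 < s ->
  enorm (perp xi *m w) ^+ 2 <= s * (s - dotv xi w) ->
  forall v, dotv xi v * dotv w v <= s * dotv v v.
Proof.
move=> x1 s0 ws v; have xx : dotv xi xi = 1 by rewrite -sqr_enorm x1 expr1n.
have xq := dotv_perp xi w x1; have wE := perp_decomp xi w.
have xp := dotv_perp xi v x1; have vE := perp_decomp xi v.
rewrite sqr_enorm in ws; move: xq wE ws xp vE.
move: (perp xi *m w) (perp xi *m v) (dotv xi w) (dotv xi v) => q p a al.
move=> xq -> ws xp ->.
have := dotv_ge0 ((2 * s) *: p + (- al) *: q).
rewrite !(dotvDl, dotvDr, dotvZl, dotvZr) (dotvC q p) (dotvC q xi) (dotvC p xi) xp xq xx.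
have Q0 := dotv_ge0 q; move: (dotv q q) (dotv p q) (dotv p p) Q0 ws => Q M S Q0 ws h.
(* 4s times the gap is the square expanded in [h], plus 4 times the quantity in [Wal], plus 3 times
   that in [Qal]. *)
rewrite -subr_ge0 -(pmulr_rge0 _ (_ : 0 < 4 * s)); last by rewrite mulr_gt0.
have Qal := mulr_ge0 (sqr_ge0 al) Q0.
have Wal : 0 <= al ^+ 2 * (s * (s - a) - Q) by rewrite mulr_ge0 ?sqr_ge0 ?subr_ge0.
lra.
Qed.

End EuclideanSpace.

(** * Positivity of sigma and the equivalence *)

(** Passing through t / 2 keeps the inequality strict: f t > f (t / 2), and the latter is at least
    the limit 0. *)
Lemma increasing_gt0 (R : realType) (f : R -> R) :
  (forall s t, 0 < s -> s < t -> f s < f t) -> f s @[s --> 0^'+] --> 0 ->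
  forall t, 0 < t -> 0 < f t.
Proof.
move=> fi f0 t t0; have h0 : 0 < t / 2 by rewrite divr_gt0.
apply: le_lt_trans (fi _ _ h0 _); last by rewrite ltr_pdivrMr // ltr_pMr // ltr1n.
apply: (ler_cvg_to f0 (cvg_cst _)); near=> s; apply/ltW/fi.
  by near: s; exact: nbhs_right_gt.
by near: s; exact: nbhs_right_lt.
Unshelve. all: by end_near.
Qed.

Lemma le_oppr_div_add (R : realType) (a q M : R) : 0 < M ->
  (a <= - (q / M) + M) = (q <= M * (M - a)).
Proof. by move=> M0; rewrite -lerBlDr lerNr opprB ler_pdivrMr // mulrC. Qed.

Theorem theorem26 (R : realType) (n N : nat) (Omega : set 'cV[R]_n)
    (u : 'cV[R]_n -> 'cV[R]_N) (x : 'cV[R]_n) (xi : 'cV[R]_N) (P : 'M[R]_(N, n)) :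
  open Omega ->
  {within Omega, continuous u} ->
  Omega x ->
  enorm xi = 1 ->
  (J1 Omega u x xi P <->
   exists sigma : R -> R,
     (forall s t : R, 0 < s -> s < t -> sigma s < sigma t) /\
     (forall t : R, 0 < t -> derivable sigma t 1) /\
     (forall t : R, 0 < t -> derive1 sigma s @[s --> t] --> derive1 sigma t) /\
     sigma s @[s --> 0^'+] --> 0 /\
     exists delta : R, 0 < delta /\
       forall z : 'cV[R]_n, z != 0 -> enorm z < delta -> Omega (z + x) ->
         let w := u (z + x) - u x - P *m z in
         dotv xi w <= - (enorm (perp xi *m w) ^+ 2 / (sigma (enorm z) * enorm z))
                      + sigma (enorm z) * enorm z).
Proof.
move=> _ _ _ x1; split.
- move=> [T [_ [_ [T0 [dl [dl0 TP]]]]]].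
  (* The factor 1/4 anticipates the constant 4 in [vee_le_perp]. *)
  pose G t e := forall z, z != 0 -> enorm z = t -> forall v : 'cV_N,
    (v^T *m T z *m v) 0 0 <= e / 4 * enorm v ^+ 2.
  have Gle t e f : G t e -> e <= f -> G t f.
    move=> Gt ef z z0 zt v; apply: (le_trans (Gt z z0 zt v)).
    by rewrite ler_wpM2r ?sqr_ge0 // ler_pM2r // invr_gt0.
  have Gsmall e : 0 < e -> exists2 r : R, 0 < r & forall t, 0 < t -> t < r -> G t e.
    move=> e0; have N0 : (0 : R) < N%:R ^+ 2 + 1 by rewrite ltr_wpDl ?sqr_ge0.
    (* N^2 is the constant of [quad_le]; adding 1 makes the denominator positive without a case on
       N. *)
    have c0 : 0 < e / 4 / (N%:R ^+ 2 + 1) by rewrite !divr_gt0.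
    have /cvgr0_norm_lt/(_ _ c0)/nbhs_norm0P[r r0 rT] := T0.
    exists r => // t t0 tr z z0 zt v.
    have zr : `|z| < r by apply: le_lt_trans (normv_le_enorm z) _; rewrite zt.
    have := rT z zr z0; rewrite ltr_pdivlMr // => Tz.
    apply: (le_trans (quad_le _ _)); rewrite ler_wpM2r ?sqr_ge0 //.
    apply: le_trans (ltW Tz); rewrite ler_wpM2l //.
    by rewrite lerDl.
  have [sigma [inc der cont lim0 [r r0 rG]]] := increasing_C1_majorant G Gle Gsmall.
  exists sigma; do 4![split=> //]; exists (Num.min dl r).
  split; first by rewrite lt_min dl0.
  move=> z z0; rewrite lt_min => /andP[zd zr] Oz; set w := _ - _ - _; cbv zeta.
  have t0 : 0 < enorm z by rewrite enorm_gt0.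
  have s0 : 0 < sigma (enorm z) by exact: increasing_gt0 _ _ inc lim0 _ t0.
  have M0 : 0 < sigma (enorm z) * enorm z by rewrite mulr_gt0.
  have := rG _ t0 zr z z0 erefl.
  have := TP (z + x) Oz; rewrite addrK -/w => /(_ t0 zd) Tw Tz.
  have l0 : 0 < sigma (enorm z) * enorm z / 4 by rewrite divr_gt0.
  have /(vee_le_perp _ _ _ x1 l0) : forall v,
      dotv xi v * dotv w v <= sigma (enorm z) * enorm z / 4 * dotv v v.
    move=> v; have := Tw v; rewrite quad_vee => /le_trans; apply.
    rewrite -scalemxAr -scalemxAl mxE -sqr_enorm.
    apply: le_trans (_ : enorm z * (sigma (enorm z) / 4 * enorm v ^+ 2) <= _).
      by rewrite ler_wpM2l // enorm_ge0.
    by rewrite le_eqVlt; apply/orP; left; apply/eqP; ring.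
  (* With l = M / 4, [h] bounds |q|^2 by M (M / 4 - a), which is stronger than the required M (M -
     a). *)
  move: (sigma (enorm z) * enorm z) M0 {l0} => M M0 h.
  by rewrite le_oppr_div_add //; have := sqr_ge0 M; lra.
- move=> [sigma [inc [der [_ [lim0 [dl [dl0 sP]]]]]]].
  exists (fun y => sigma (enorm y) *: 1%:M); split; last split; last split.
  + by move=> y _; rewrite linearZ /= trmx1.
  + apply: continuous_in_subspaceT => y; rewrite inE /= => y0.
    have sc : {for enorm y, continuous sigma}.
      apply: differentiable_continuous; apply/derivable1_diffP; apply: der.
      by rewrite enorm_gt0.
    have sec := continuous_comp (continuous_enorm y) sc.
    exact: cvgZr_tmp sec.
  + rewrite -[X in _ --> X](scale0r 1%:M); apply: cvgZr_tmp.
    exact: cvg_comp cvg_enorm_at_right lim0.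
  exists dl; split=> // z Oz t0 zd v.
  have z0 : z - x != 0 by rewrite -enorm_gt0.
  have s0 : 0 < sigma (enorm (z - x)) by exact: increasing_gt0 _ _ inc lim0 _ t0.
  have M0 : 0 < sigma (enorm (z - x)) * enorm (z - x) by rewrite mulr_gt0.
  have := sP _ z0 zd; rewrite subrK => /(_ Oz) /=.
  rewrite le_oppr_div_add // => h.
  rewrite quad_vee scalerA (mulrC (enorm _)) -scalemxAr -scalemxAl mulmx1 mxE.
  exact: (perp_le_vee _ _ _ x1 M0 h).
Qed.
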